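(* Let $z\in\{-1,0,1\}^{\mathbb{N}^*}$ be such that $$\liminf_{N\to\infty}\frac1N\sum_{n\le N}z(n)^2>0,$$ and suppose moreover that: (a') the sequence $z^2=(z(n)^2)_{n\in\mathbb{N}^*}\in\{0,1\}^{\mathbb{N}^*}$ is quasi-generic for some shift-invariant Borel probability measure $\nu$ on $\{0,1\}^{\mathbb{N}^*}$; (b') $H:=h_{top}(\mathrm{supp}(\nu))>0$; (c') there exist integers $q\ge 2$ and $b\ge1$ such that, for all $m\ge1$, the number of ergodic components of the action of $S^{q^m}$ on $(\{0,1\}^{\mathbb{N}^*},\nu)$ is bounded by $b$. Then for every $\varepsilon>0$ there exists a Toeplitz sequence $t=(t_n)_{n\in\mathbb{N}^*}\in\{-1,0,1\}^{\mathbb{N}^*}$ such that $$h_{top}(t)\ge(1-\varepsilon)H\quad\text{and}\quad \liminf_{N\to\infty}\frac1N\sum_{n\le N}t_n\,z(n)>0.$$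
   Context: $\mathbb{N}^*=\{1,2,3,\dots\}$; sums $\sum_{n\le N}$ are over $1\le n\le N$; logarithms are to base $2$. For a finite alphabet $A$, $S$ is the left shift on $A^{\mathbb{N}^*}$, $(Sw)(n)=w(n+1)$, and $A^{\mathbb{N}^*}$ has the product topology. A point $w\in A^{\mathbb{N}^*}$ is quasi-generic for a probability measure $\nu$ if $\frac1{N_k}\sum_{n\le N_k}\delta_{S^nw}\to\nu$ weakly along some increasing sequence $(N_k)$. A block is an element of $A^n$ for some $n\ge1$. For a shift-invariant probability measure $\nu$ on $A^{\mathbb{N}^*}$, $\nu(B)$ for a block $B\in A^n$ denotes the measure of the cylinder of sequences starting with $B$, and $$h_{top}(\mathrm{supp}(\nu)):=\lim_{n\to\infty}\frac1n\log\left|\{B\in A^n:\nu(B)>0\}\right|.$$ For a sequence $w$, $h_{top}(w):=\lim_{n\to\infty}\frac1n\log p_n(w)$, where $p_n(w)$ is the number of distinct blocks of length $n$ appearing in $w$. A sequence $t\in A^{\mathbb{N}^*}$ is Toeplitz if for each $a\in\mathbb{N}^*$ there exists $r_a\in\mathbb{N}^*$ such that $t(a)=t(a+kr_a)$ for every $k\in\mathbb{N}^*$. *)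

(* Defs.v *)
From HB Require Import structures.
From mathcomp Require Import all_boot all_order all_algebra.
From mathcomp Require Import all_classical all_reals all_analysis.
Import Order.TTheory GRing.Theory Num.Theory.
Import numFieldNormedType.Exports.

Set Implicit Arguments.
Unset Strict Implicit.
Unset Printing Implicit Defensive.

Local Open Scope classical_set_scope.
Local Open Scope ring_scope.

(* A sequence (w(n))_{n >= 1} is encoded by a function on nat whose value at i
   is the term w(i+1); the sum of z(n) over 1 <= n <= N is thus
   \sum_(i < N) z i. *)

(* The alphabet {-1, 0, 1}, as a finite subtype of int. *)
Definition trit := seq_sub [:: (-1 : int); 0; 1].

Definition trit_val (R : realType) (a : trit) : R := (val a)%:~R.

Definition left_shift (A : Type) (w : nat -> A) : nat -> A := fun i => w i.+1.

(* The digits of {0, 1} are booleans, with true standing for 1. *)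
Definition square_seq (z : nat -> trit) : nat -> bool :=
  fun i => val (z i) ^+ 2 == 1.

Definition mean (R : realType) (u : nat -> R) : nat -> R :=
  fun N => N%:R^-1 * \sum_(i < N) u i.

Definition log2 (R : realType) (x : R) : R := ln x / ln 2.

Definition borel_cantor :=
  g_sigma_algebraType [set U : set cantor_space | open U].

Definition block (A : Type) (w : nat -> A) (i n : nat) : n.-tuple A :=
  [tuple w (i + j)%N | j < n].

Definition cylinder (n : nat) (B : n.-tuple bool) : set borel_cantor :=
  [set w | block w 0 n = B].

Definition complexity (A : finType) (w : nat -> A) (n : nat) : nat :=
  #|[set B : n.-tuple A | `[< exists i, block w i n = B >]]%SET|.

Definition htop (R : realType) (A : finType) (w : nat -> A) : R :=
  limn (fun n => n%:R^-1 * log2 (complexity w n)%:R : R).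

Definition htop_supp (R : realType) (nu : probability borel_cantor R) : R :=
  limn (fun n => n%:R^-1 *
    log2 #|[set B : n.-tuple bool | (0 < nu (cylinder B))%E]%SET|%:R : R).

(* (1/N) (\d_(S w) + ... + \d_(S^N w)) *)
Definition empirical (R : realType) (w : nat -> bool) (N : nat) :
    {measure set borel_cantor -> \bar R} :=
  mscale (N%:R^-1)%:nng
    (msum (fun n => \d_(iter n.+1 (@left_shift bool) w : borel_cantor)) N).

(* Continuous functions on the Cantor space are bounded, so no boundedness
   condition is imposed on the test functions. *)
Definition weak_cvg (R : realType)
    (mu : nat -> {measure set borel_cantor -> \bar R})
    (nu : {measure set borel_cantor -> \bar R}) : Prop :=
  forall f : cantor_space -> R, continuous f ->
    (\int[mu k]_x (f x)%:E)%E @[k --> \oo] --> (\int[nu]_x (f x)%:E)%E.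

Definition quasi_generic (R : realType) (w : nat -> bool)
    (nu : probability borel_cantor R) : Prop :=
  exists N : nat -> nat, {homo N : i j / (i < j)%N} /\
    weak_cvg (fun k => empirical R w (N k)) nu.

Definition invariant_measure (R : realType) (T : borel_cantor -> borel_cantor)
    (mu : probability borel_cantor R) : Prop :=
  forall A, measurable A -> mu (T @^-1` A) = mu A.

Definition ergodic_measure (R : realType) (T : borel_cantor -> borel_cantor)
    (mu : probability borel_cantor R) : Prop :=
  invariant_measure T mu /\
  forall A, measurable A -> T @^-1` A = A -> mu A = 0%E \/ mu A = 1%E.

(* The ergodic decomposition of nu has exactly k components: nu is a convex
   combination, with positive weights, of k distinct ergodic measures. *)
Definition has_ergodic_components (R : realType)
    (T : borel_cantor -> borel_cantor) (nu : probability borel_cantor R)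
    (k : nat) : Prop :=
  exists (c : 'I_k -> R) (mu : 'I_k -> probability borel_cantor R),
    [/\ forall i, 0 < c i,
        \sum_i c i = 1,
        injective mu,
        forall i, ergodic_measure T (mu i) &
        forall A, measurable A -> nu A = (\sum_i (c i)%:E * mu i A)%E].

Definition toeplitz (A : Type) (t : nat -> A) : Prop :=
  forall a : nat, exists r : nat, (0 < r)%N /\
    forall k : nat, (0 < k)%N -> t a = t (a + k * r)%N.

(* Main.v *)
(** Fill the positions in stages: stage i copies z on an initial segment of length
M_i, except where earlier stages have already written, and repeats what it wrote
with period L_i = q^(m_i). If the L_i grow so fast that the sum of M_i/L_i is at
most d, the resulting t is Toeplitz and differs from z on a set of density at most
d in every initial segment, which bounds the correlation from below.

For the entropy, let L = q^m. One of the at most b ergodic components of S^L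
carries at least a fraction 1/b of the L-blocks of nu. Almost every point of this
component contains all of its L-blocks at multiples of L, so a single word of
positive nu-measure does, and by quasi-genericity that word occurs in z^2
arbitrarily far. Hence in any tail of z^2 all these blocks occur in one residue
class mod L. For L = L_i, the positions written by the first i stages cut out the
same set of density at most d in all windows of this class, and outside it t still
agrees with z if M_{i+1} is large enough. So t has at least 2^{-dL}/b times as
many L-blocks as nu. *)

Require Import Defs.
From mathcomp Require Import all_boot all_order all_algebra.
From mathcomp Require Import all_classical all_reals all_analysis.
From mathcomp Require Import zify lra.
Import Order.TTheory GRing.Theory Num.Theory.
Import numFieldNormedType.Exports.

Local Open Scope classical_set_scope.
Local Open Scope ring_scope.

(** * Limits inferior and Fekete's lemma *)

Lemma limn_inf_eventually {R : realType} {u : nat -> R} {c : R} :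
  bounded_fun u -> c < limn_inf u -> exists N, forall n, (N <= n)%N -> c <= u n.
Proof.
move=> ub; rewrite limn_infE//.
move=> /sup_gt[|_ [N _ <-] cN]; first by exists (infs u 0), 0%N.
exists N => n Nn; apply: (le_trans (ltW cN)); apply: ge_inf; last by exists n.
exact/has_lbound_sdrop/bounded_fun_has_lbound.
Qed.

Lemma limn_inf_ge {R : realType} {u : nat -> R} {c : R} (N : nat) :
  bounded_fun u -> (forall n, (N <= n)%N -> c <= u n) -> c <= limn_inf u.
Proof.
move=> ub cu; rewrite limn_infE//.
apply: (@le_trans _ _ (infs u N)); last first.
  by apply: ub_le_sup; [exact: bounded_fun_has_ubound_infs|exists N].
apply: lb_le_inf; first by exists (u N), N => /=.
by move=> _ [n /= Nn <-]; exact: cu.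
Qed.

Section fekete.
Context {R : realType} {u : nat -> R}.
Hypothesis u_ge0 : forall n, 0 <= u n.
Hypothesis u_sub : forall m n, u (m + n)%N <= u m + u n.

(** The shift to [n.+1] leaves out the index 0, whose slope is 0 by the convention [0^-1 = 0] and
    would force the infimum to be 0. *)
Let slopes := [set n.+1%:R^-1 * u n.+1 | n in [set: nat]].

Let slopes_lb : has_lbound slopes.
Proof. by exists 0 => _ [n _ <-]; rewrite mulr_ge0. Qed.

Lemma subadditive_mul (d k r : nat) : u (k * d + r)%N <= k%:R * u d + u r.
Proof.
elim: k => [|k IH]; first by rewrite mul0r add0r.
rewrite mulSn -addnA (le_trans (u_sub _ _))// -natr1 mulrDl mul1r; lra.
Qed.

Lemma fekete_cvg : (fun n => n%:R^-1 * u n) @ \oo --> inf slopes.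
Proof.
apply/cvgrPdist_le => /= e e_gt0.
have slopes_inf : has_inf slopes.
  by split; [exists (1%:R^-1 * u 1%N), 0%N|exact: slopes_lb].
have e2_gt0 : 0 < e / 2 by rewrite divr_gt0.
have [_ [d _ <-] ud] := inf_adherent e2_gt0 slopes_inf.
(* [C] bounds [u] at every remainder modulo [d.+1]; its share [C / n] drops to [e / 2] once
   [2 * C / e <= n]. *)
pose C := \sum_(r < d.+1) u r.
have C_ge0 : 0 <= C by exact: sumr_ge0.
have Cr r : (r < d.+1)%N -> u r <= C.
  by move=> rd; rewrite /C (bigD1 (Ordinal rd))//= lerDl sumr_ge0.
near=> n.
have n_gt0 : (0 < n)%N by near: n; exists 1%N.
have nR : 0 < n%:R :> R by rewrite ltr0n.
rewrite ler_norml; apply/andP; split; last first.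
  rewrite lerBlDr; apply: (@le_trans _ _ (n%:R^-1 * u n)); last first.
    by rewrite lerDr ltW.
  by apply: ge_inf => //; exists n.-1 => //; rewrite prednK.
rewrite lerBrDl lerBlDr.
apply: (@le_trans _ _ (d.+1%:R^-1 * u d.+1 + e / 2)); last first.
  by rewrite (le_trans (lerD (ltW ud) (lexx _)))// -addrA -splitr.
rewrite ler_pdivrMl// [X in u X](divn_eq n d.+1).
apply: (le_trans (subadditive_mul _ _ _)); rewrite mulrDr lerD//.
  rewrite mulrA ler_wpM2r// ler_pdivlMr// -natrM ler_nat.
  exact: leq_trunc_div.
apply: (le_trans (Cr _ _)); first by rewrite ltn_mod.
have : 2 * C / e <= n%:R by near: n; exact: nbhs_infty_ger.
rewrite ler_pdivrMr//; lra.
Unshelve. all: by end_near. Qed.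

(** The limit is the infimum of the slopes, so the entropy of [nu] is bounded by its block count at
    each single length, without error term. *)
Lemma fekete_lim_le (n : nat) : (0 < n)%N ->
  limn (fun n => n%:R^-1 * u n) <= n%:R^-1 * u n.
Proof.
move=> n_gt0; rewrite (cvg_lim _ fekete_cvg)//.
by apply: ge_inf => //; exists n.-1 => //; rewrite prednK.
Qed.

(** Convergence is already known, so bounds at arbitrarily large indices suffice; for the Toeplitz
    sequence only the periods [L i] are controlled. *)
Lemma fekete_lim_ge (c : R) :
  (forall N, exists2 n, (N <= n)%N & c <= n%:R^-1 * u n) ->
  c <= limn (fun n => n%:R^-1 * u n).
Proof.
move=> cu; rewrite (cvg_lim _ fekete_cvg)//.
rewrite leNgt; apply/negP => lc.
have [N _ NP] : \forall n \near \oo, n%:R^-1 * u n < c.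
  exact: (cvgr_lt _ fekete_cvg).
by have [n Nn] := cu N; rewrite leNgt NP.
Qed.

End fekete.

(** * Base-2 logarithms of block counts *)

Section log2.
Context {R : realType}.
Implicit Types x y : R.

Let ln2_gt0 : 0 < ln 2 :> R.
Proof. by rewrite ln_gt0// ltr1n. Qed.

Lemma log2M x y : 0 < x -> 0 < y -> log2 (x * y) = log2 x + log2 y.
Proof. by move=> x0 y0; rewrite /log2 lnM ?posrE// mulrDl. Qed.

Lemma ler_log2 x y : 0 < x -> x <= y -> log2 x <= log2 y.
Proof.
move=> x0 xy; rewrite /log2 ler_pM2r ?invr_gt0// ler_ln ?posrE//.
exact: lt_le_trans xy.
Qed.

Lemma log2_nat_ge0 (n : nat) : 0 <= log2 n%:R :> R.
Proof.
case: n => [|n]; first by rewrite /log2 ln0 ?mul0r.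
by rewrite /log2 divr_ge0 ?ln_ge0 ?(ltW ln2_gt0)// ler1n.
Qed.

Lemma log2X2 (n : nat) : log2 (2 ^ n)%:R = n%:R :> R.
Proof. by rewrite /log2 natrX lnXn// -[_ *+ n]mulr_natl mulfK// gt_eqF. Qed.

Lemma log2_submultiplicative (a : nat -> nat) :
  (forall n, 0 < a n)%N -> (forall m n, a (m + n) <= a m * a n)%N ->
  forall m n, log2 (a (m + n)%N)%:R <= log2 (a m)%:R + log2 (a n)%:R :> R.
Proof.
move=> a0 aM m n; rewrite -log2M ?ltr0n// -natrM ler_log2 ?ltr0n// ler_nat.
exact: aM.
Qed.

End log2.

(** * Blocks and complexity *)

Lemma tnth_block {A : Type} (w : nat -> A) (i n : nat) (j : 'I_n) :
  tnth (block w i n) j = w (i + j)%N.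
Proof. by rewrite tnth_mktuple. Qed.

(** Cutting a block into prefix and suffix is injective. This serves the submultiplicativity of both
    the complexity and the number of support blocks. *)
Lemma card_split_le {A : finType} (m n : nat) (X : {set (m + n).-tuple A})
    (Y : {set m.-tuple A}) (Z : {set n.-tuple A}) :
  (forall B, B \in X -> [tuple tnth B (lshift n j) | j < m] \in Y /\
     [tuple tnth B (rshift m j) | j < n] \in Z) -> (#|X| <= #|Y| * #|Z|)%N.
Proof.
move=> h; rewrite -cardsX.
pose f (B : (m + n).-tuple A) := ([tuple tnth B (lshift n j) | j < m],
  [tuple tnth B (rshift m j) | j < n]).
have f_inj : injective f.
  move=> B C BC; apply: eq_from_tnth => k; case: (split_ordP k) => l ->.
    by have := congr1 (fun u => tnth u.1 l) BC; rewrite !tnth_mktuple.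
  by have := congr1 (fun u => tnth u.2 l) BC; rewrite !tnth_mktuple.
rewrite -(card_imset _ f_inj).
apply/subset_leq_card/fintype.subsetP => _ /imsetP[B /h[? ?] ->].
by rewrite !inE/=; apply/andP.
Qed.

Lemma complexity_gt0 {A : finType} (w : nat -> A) (n : nat) :
  (0 < complexity w n)%N.
Proof.
apply/card_gt0P; exists (block w 0 n).
by rewrite inE; apply/asboolP; exists 0%N.
Qed.

Lemma complexityD {A : finType} (w : nat -> A) (m n : nat) :
  (complexity w (m + n) <= complexity w m * complexity w n)%N.
Proof.
apply: card_split_le => B; rewrite inE => /asboolP[i iB]; rewrite -iB.
split; rewrite inE; apply/asboolP.
  by exists i; apply: eq_from_tnth => j; rewrite !tnth_mktuple.
by exists (i + m)%N; apply: eq_from_tnth => j; rewrite !tnth_mktuple/= addnA.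
Qed.

(** * Toeplitz sequences filled in stages *)

Lemma sum_geometric_weights (N j : nat) (a : nat -> nat) :
  (forall i, (i < j)%N -> (a i * 2 ^ i.+1 <= N)%N) ->
  (\sum_(i < j) a i <= N)%N.
Proof.
(* The induction carries the sharper bound [N * (1 - 2 ^ - j)], cleared of denominators and
   subtraction. *)
move=> aN; suff: ((\sum_(i < j) a i) * 2 ^ j + N <= N * 2 ^ j)%N.
  move=> h; rewrite -(@leq_pmul2r (2 ^ j)) ?expn_gt0//.
  exact: leq_trans (leq_addr _ _) h.
elim: j aN => [|j IH] aN; first by rewrite big_ord0; lia.
rewrite big_ord_recr/=.
have {}IH : ((\sum_(i < j) a i) * 2 ^ j + N <= N * 2 ^ j)%N.
  by apply: IH => i ij; apply: aN; lia.
have := aN j (ltnSn j); rewrite expnS mulnDl !(mulnCA _ 2%N); move: IH.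
 by move: ((\sum_(_ < _) _) * _)%N (a j * _)%N (N * _)%N => x y w; lia.
Qed.

Lemma sum_residues_le (s d M n c : nat) : (n <= c * d)%N ->
  (\sum_(j < n) ((s + j) %% d < M) <= c * M)%N.
Proof.
move=> ncd; case: (posnP d) => [d0|d_gt0].
  by move: ncd; rewrite d0 muln0 leqn0 => /eqP ->; rewrite big_ord0.
rewrite -(big_mkord xpredT (fun j => ((s + j) %% d < M)%N : nat)).
rewrite -big_mkcond/= sum1_count -size_filter.
(* The quotient is that of [j], not of [s + j], so it stays below [c] for every [s]; the residue of
   [s + j] still separates indices with equal quotient. *)
pose f j := ((s + j) %% d, j %/ d)%N.
have f_inj : injective f.
  move=> i j [ij qij]; rewrite (divn_eq i d) (divn_eq j d) qij; congr addn.
  by apply/eqP; rewrite -(eqn_modDl s); apply/eqP.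
rewrite -(size_map f) -[X in (_ <= X)%N](_ :
    size [seq (y, x) | x <- iota 0 c, y <- iota 0 M] = _); last first.
  by rewrite size_allpairs !size_iota.
apply: uniq_leq_size; first by rewrite map_inj_uniq// filter_uniq// iota_uniq.
move=> _ /mapP[j + ->]; rewrite mem_filter mem_index_iota => /andP[jM jn].
apply/allpairsP; exists (j %/ d, (s + j) %% d)%N; split => //=.
  by rewrite mem_iota/= add0n ltn_divLR//; lia.
by rewrite mem_iota.
Qed.

Section fill.
Context {A : Type} (L M : nat -> nat) (z : nat -> A).
Hypothesis M_le_L : forall i, (M i <= L i)%N.
Hypothesis M_gt0 : forall i, (0 < M i)%N.
Hypothesis M_incr : forall i, (M i < M i.+1)%N.
Hypothesis L_dvd : forall i, (L i %| L i.+1)%N.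

(* Stage [i] copies [z] to the positions below [M i] left free by the previous
   stages and repeats the copy with period [L i]; [level n] is the stage that
   fills the position [n]. Stage [n] fills it at the latest, as [n < M n], so
   that the search below never fails. *)
Definition level (n : nat) : nat :=
  find (fun i => n %% L i < M i)%N (iota 0 n.+1).

Definition fill (n : nat) : A := z (n %% L (level n)).

Let M_gt (i : nat) : (i < M i)%N.
Proof. by elim: i => [|i IH]//; exact: leq_ltn_trans IH (M_incr i). Qed.

Let L_gt0 (i : nat) : (0 < L i)%N.
Proof. exact: leq_trans (M_gt0 i) (M_le_L i). Qed.

Let has_level (n : nat) : has (fun i => n %% L i < M i)%N (iota 0 n.+1).
Proof.
apply/hasP; exists n; first by rewrite mem_iota/=; lia.
exact: leq_ltn_trans (leq_mod _ _) (M_gt n).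
Qed.

Lemma level_le (n : nat) : (level n <= n)%N.
Proof. by have := has_level n; rewrite has_find size_iota ltnS. Qed.

Lemma level_lt (n : nat) : (n %% L (level n) < M (level n))%N.
Proof.
by have := nth_find 0%N (has_level n); rewrite nth_iota// ltnS level_le.
Qed.

Lemma ltn_level (n i : nat) : (i < level n)%N -> (M i <= n %% L i)%N.
Proof.
move=> il; have := before_find 0%N il.
rewrite nth_iota ?(leq_trans il (leqW (level_le n)))//.
by rewrite add0n ltnNge => /negbFE.
Qed.

Lemma levelE (n i : nat) : (n %% L i < M i)%N ->
  (forall j, (j < i)%N -> (M j <= n %% L j)%N) -> level n = i.
Proof.
move=> ni nj; case: (ltngtP (level n) i) => // h.
  by have := nj _ h; rewrite leqNgt level_lt.
by have := ltn_level _ _ h; rewrite leqNgt ni.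
Qed.

Let L_dvd_le (i j : nat) : (i <= j)%N -> (L i %| L j)%N.
Proof.
move=> /subnKC <-; elim: (j - i)%N => [|k IH]; first by rewrite addn0.
by rewrite addnS; exact: dvdn_trans IH (L_dvd _).
Qed.

(** Every period up to stage [level a] divides [L (level a)], so translating by multiples of the
    latter changes neither the level nor the position copied. *)
Lemma toeplitz_fill : toeplitz fill.
Proof.
move=> a; exists (L (level a)); split => // k _.
have mod_eq i : (i <= level a)%N -> ((a + k * L (level a)) %% L i = a %% L i)%N.
  move=> il; rewrite -modnDmr (_ : (k * L (level a)) %% L i = 0)%N ?addn0//.
  by apply/eqP/dvdn_mull/L_dvd_le.
rewrite /fill (@levelE (a + _) (level a)) ?mod_eq ?level_lt// => j jl.
by rewrite mod_eq ?ltn_level// ltnW.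
Qed.

Lemma fill_fresh (n j : nat) : (n < M j)%N ->
  (forall i, (i < j)%N -> (M i <= n %% L i)%N) -> fill n = z n.
Proof.
move=> nM fresh; have nL : (n %% L j = n)%N.
  by rewrite modn_small// (leq_trans nM).
by rewrite /fill (@levelE n j) ?nL.
Qed.

Lemma fill_neq (n : nat) : fill n <> z n -> (L (level n) <= n)%N.
Proof.
move=> h; rewrite leqNgt; apply/negP => nL; apply: h.
by rewrite /fill modn_small.
Qed.

(** A mismatch filled at stage [i] lies at or beyond [L i]. Dropping the first period makes the
    number of periods round down, so the bound is useful for every [N]. The boolean [e] stands in
    for the mismatch, [A] having no decidable equality here. *)
Lemma sum_fill_neq_le (N : nat) (e : nat -> bool) :
  (forall n, e n -> fill n <> z n) ->
  (\sum_(n < N) e n <= \sum_(i < N) (N %/ L i) * M i)%N.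
Proof.
move=> e_neq.
pose late i n := ((L i <= n) && (n %% L i < M i))%N.
apply: (@leq_trans (\sum_(n < N) \sum_(i < N) late i n)%N).
  apply: leq_sum => n _; case en : (e n) => //.
  have ln : (level n < N)%N by exact: leq_ltn_trans (level_le n) _.
  rewrite (bigD1 (Ordinal ln))//= /late fill_neq ?level_lt//.
  exact: e_neq.
rewrite exchange_big/=; apply: leq_sum => i _.
rewrite -(big_mkord xpredT (fun n => late i n : nat)).
case: (leqP N (L i)) => NL.
  rewrite big_nat big1// => n /andP[_ nN].
  by rewrite /late leqNgt (leq_trans nN NL).
rewrite (@big_cat_nat _ _ _ (L i)) ?(ltnW NL)//= big_nat big1; last first.
  by move=> n /andP[_ nL]; rewrite /late leqNgt nL.
rewrite add0n -{1}[L i]add0n big_addn big_mkord.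
apply: leq_trans (@sum_residues_le (L i) (L i) (M i) (N - L i) (N %/ L i) _).
  by apply: leq_sum => n _; rewrite /late addnC leq_addr.
have := L_gt0 i; have := ltn_ceil N (L_gt0 i); lia.
Qed.

End fill.

(* A block [B] is recovered from the block of [t] at its occurrence and from the
   digits of [B] at the positions in [F]. *)
Lemma card_blocks_le (A : finType) (t : nat -> A) (g : A -> bool) (L : nat)
    (F : {set 'I_L}) (BB : {set L.-tuple bool}) :
  (forall B, B \in BB -> exists s, forall j, j \notin F ->
    g (t (s + j)%N) = tnth B j) ->
  (#|BB| <= complexity t L * 2 ^ #|F|)%N.
Proof.
move=> occ.
have /choice[s sP] : forall B, exists s, B \in BB -> forall j, j \notin F ->
    g (t (s + j)%N) = tnth B j.
  move=> B; case BBB : (B \in BB); last by exists 0%N.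
  by have [s ?] := occ _ BBB; exists s.
pose f B := (block t (s B) L, [set j in F | tnth B j])%SET.
have f_inj : {in BB &, injective f}.
  move=> B C BBB CBB BC; apply: eq_from_tnth => j.
  have [jF|jF] := boolP (j \in F).
    by have /setP/(_ j) := congr1 snd BC; rewrite !inE jF.
  rewrite -(sP _ BBB)// -(sP _ CBB)//.
  by have := congr1 (fun u => tnth u.1 j) BC; rewrite !tnth_mktuple => ->.
rewrite -(card_in_imset f_inj) -card_powerset -cardsX.
apply/subset_leq_card/fintype.subsetP => _ /imsetP[B BBB ->].
rewrite !inE/=; apply/andP; split; first by apply/asboolP; exists (s B).
by apply/fintype.subsetP => j; rewrite inE => /andP[].
Qed.

(** The choices alternate: [M i.+1] depends on [m i] and [M i], and [m i.+1] is then taken large in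
    terms of [M i.+1]. *)
Lemma exists_levels (q K : nat) (P : nat -> nat -> nat -> Prop) :
  (1 < q)%N ->
  (forall m M, (0 < m)%N -> exists M', (M < M')%N /\ P m M M') ->
  exists m M : nat -> nat, forall i,
    [/\ (0 < m i)%N /\ (i <= m i)%N, (m i <= m i.+1)%N, (0 < M i < M i.+1)%N,
        (M i * (K * 2 ^ i.+1) <= q ^ m i)%N & P (m i) (M i) (M i.+1)].
Proof.
move=> q1 H.
have /choice[f fP] : forall mM : nat * nat, exists M',
    (0 < mM.1)%N -> (mM.2 < M')%N /\ P mM.1 mM.2 M'.
  move=> [m M]/=; case: (posnP m) => m0; first by exists 0%N.
  by have [M' ?] := H m M m0; exists M'.
(* Since [n < q ^ n], an exponent of at least [M i * (K * 2 ^ i.+1)] is enough. Adding the previous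
   exponent gives monotonicity, and adding 1 gives positivity and growth. *)
pose st := fix st i : nat * nat := if i is i'.+1 then
   ((st i').1 + f (st i') * (K * 2 ^ i.+1) + 1, f (st i'))%N
  else (1 * (K * 2 ^ 1) + 1, 1)%N.
have st_gt0 i : (0 < (st i).1)%N /\ (i <= (st i).1)%N.
  by elim: i => [|i IH] /=; lia.
have stM i : ((st i).2 < (st i.+1).2)%N by have [] := fP (st i) (st_gt0 i).1.
exists (fst \o st), (snd \o st) => i /=; split => //.
- rewrite /= -/st; lia.
- by rewrite stM andbT; elim: i => [|i IH]//; exact: leq_ltn_trans (stM i).
- apply: leq_trans (ltnW (ltn_expl _ q1)).
  by case: i => [|i]; rewrite [st _]/= ?leq_addr// -/st /=; lia.
- by have [] := fP (st i) (st_gt0 i).1.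
Qed.

(** * Quasi-generic sequences and ergodic components *)

(** Blocks read finitely many coordinates, so they are locally constant: cylinders are open, hence
    measurable, and their indicators are continuous test functions. *)
Lemma near_block (x : cantor_space) (s n : nat) :
  \forall y \near x, block (y : nat -> bool) s n = block (x : nat -> bool) s n.
Proof.
have near_coord (j : 'I_n) : \forall y \near x,
    proj (s + j)%N y = proj (s + j)%N x.
  exact: (@proj_continuous nat (fun _ => bool) (s + j)%N x _ (discrete_set1 _)).
have h := filter_forall (nbhs_filter x) near_coord.
apply: filterS h => y yx; apply: eq_from_tnth => j.
by rewrite !tnth_block; exact: yx.
Qed.

Lemma measurable_block (s n : nat) (B : n.-tuple bool) :
  measurable ([set x | block x s n = B] : set borel_cantor).
Proof.
apply: sub_sigma_algebra; rewrite /= openE => x /= xB.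
by apply: filterS (near_block x s n) => y /= ->.
Qed.

Lemma continuous_cylinder_indic {R : realType} (n : nat) (B : n.-tuple bool) :
  continuous (\1_(cylinder B) : cantor_space -> R).
Proof.
move=> x; apply: cvg_near_cst; apply: filterS (near_block x 0 n) => y yx.
rewrite !indicE (_ : (y \in cylinder B) = (x \in cylinder B))//.
by apply/idP/idP; rewrite !inE /cylinder/= yx.
Qed.

Lemma iter_left_shift {A : Type} (w : nat -> A) (s i : nat) :
  iter s (@left_shift A) w i = w (s + i)%N.
Proof. by elim: s i => // s IH i; rewrite iterS /left_shift IH addnS addSn. Qed.

Lemma block_iter_left_shift {A : Type} (w : nat -> A) (s i n : nat) :
  block (iter s (@left_shift A) w) i n = block w (s + i) n.
Proof.
by apply: eq_from_tnth => j; rewrite !tnth_block iter_left_shift addnA.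
Qed.

Lemma empiricalE {R : realType} (w : nat -> bool) (N : nat)
    (A : set borel_cantor) :
  empirical R w N A = (N%:R^-1 *
    \sum_(n < N) \1_A (iter n.+1 (@left_shift bool) w : borel_cantor))%:E.
Proof. by rewrite /empirical /= /mscale /= /msum /= EFinM -sumEFin. Qed.

(** If [B] never started at or after [M], its empirical frequency would be at most [M / N k], which
    tends to 0 and not to [nu (cylinder B)]. *)
Lemma quasi_generic_occurs {R : realType} {w : nat -> bool}
    {nu : probability borel_cantor R} (w_nu : quasi_generic w nu)
    (n : nat) (B : n.-tuple bool) (M : nat) :
  (0 < nu (cylinder B))%E -> exists2 s, (M <= s)%N & block w s n = B.
Proof.
move=> B_gt0; apply: contrapT => noB.
have {}noB s : (M <= s)%N -> block w s n <> B.
  by move=> Ms sB; apply: noB; exists s.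
have [N [N_incr /(_ _ (continuous_cylinder_indic _ B))]] := w_nu.
have mB : measurable (cylinder B) by exact: measurable_block.
rewrite integral_indic// setIT; under eq_fun do rewrite integral_indic// setIT.
have fin : nu (cylinder B) \is a fin_num by exact: fin_num_measure.
move=> cvgB.
have {}cvgB : (fun k => fine (empirical R w (N k) (cylinder B))) @ \oo -->
    fine (nu (cylinder B)).
  by apply: fine_cvg; rewrite fineK.
have c_gt0 : 0 < fine (nu (cylinder B)) by rewrite fine_gt0// B_gt0 ltey_eq fin.
move: c_gt0 cvgB; set c := fine _ => c_gt0 cvgB.
have N_ge k : (k <= N k)%N.
  by elim: k => // k IH; exact: leq_ltn_trans IH (N_incr _ _ (ltnSn k)).
have [k] : exists k, c / 2 < fine (empirical R w (N k) (cylinder B)) /\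
    2 * M%:R / c + 1 <= k%:R.
  apply: (@filter_ex _ \oo); near=> k; split; near: k.
    by apply: (cvgr_gt _ cvgB); rewrite ltr_pdivrMr//; lra.
  exact: nbhs_infty_ger.
rewrite empiricalE/= => -[].
set S := \sum_(i < _) _ => cS kM.
have : S <= M%:R.
  (* Modulo [(N k).+1] these indices are unreduced, so counting the indices below [M] becomes a
     residue count over one period. *)
  apply: (@le_trans _ _ (\sum_(i < N k) ((0 + i) %% (N k).+1 < M)%N%:R)).
    apply: ler_sum => i _; rewrite add0n modn_small; last first.
      by rewrite (leq_trans (ltn_ord i)).
    case: ltnP => iM; first by rewrite /indic; case: (_ \in _).
    rewrite indicE memNset// /cylinder/=.
    rewrite -iterS block_iter_left_shift; apply: noB; lia.
  rewrite -natr_sum ler_nat -[leqRHS]mul1n.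
  by apply: (@sum_residues_le 0 (N k).+1 M (N k) 1); lia.
have kN : k%:R <= (N k)%:R :> R by rewrite ler_nat.
have k_gt0 : 0 < (N k)%:R :> R.
  apply: lt_le_trans kN; apply: lt_le_trans kM.
  by rewrite ltr_wpDl// divr_ge0 ?mulr_ge0// ltW.
move: cS; rewrite ltr_pdivlMl// => cS SM.
have : 2 * M%:R / c < k%:R by lra.
rewrite ltr_pdivrMr// => kM'.
have : c * k%:R <= c * (N k)%:R by rewrite ler_pM2l.
lra.
Unshelve. all: by end_near. Qed.

(** Ergodicity concerns sets equal to their preimage, whereas the set of points with some occurrence
    merely contains its preimage; hence the passage to infinitely many occurrences. *)
Lemma ergodic_ae_occurs {R : realType} (L n : nat) (B : n.-tuple bool)
    (mu : probability borel_cantor R) :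
  ergodic_measure (iter L (@left_shift bool)) mu ->
  (0 < mu (cylinder B))%E ->
  {ae mu, forall x : borel_cantor, exists k, block x (k * L) n = B}.
Proof.
move=> [mu_inv mu_erg] B_gt0; set T := iter L _ in mu_inv mu_erg.
have TE (x : nat -> bool) k : block (T x) (k * L) n = block x (k.+1 * L) n.
  by rewrite block_iter_left_shift mulSn.
(* The points with infinitely many occurrences form the strictly invariant set
   [\bigcap_i A i], and all the [A i] have the measure of [A 0]. *)
pose A i : set borel_cantor :=
  \bigcup_(k in [set k | (i <= k)%N]) [set x | block x (k * L) n = B].
have mA i : measurable (A i).
  by apply: bigcup_measurable => k _; exact: measurable_block.
have AS i : T @^-1` A i = A i.+1.
  apply/seteqP; split => x [k /= ik xB].
    by exists k.+1 => //=; rewrite -TE.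
  by case: k ik xB => // k ik xB; exists k => //=; rewrite TE.
have muA i : mu (A i) = mu (A 0%N).
  by elim: i => // i IH; rewrite -AS mu_inv.
have mD : measurable (\bigcap_i A i) by exact: bigcapT_measurable.
have muD : mu (\bigcap_i A i) = mu (A 0%N).
  have : mu \o A @ \oo --> mu (\bigcap_i A i).
    apply: nonincreasing_cvg_mu => //.
      by rewrite ltey_eq fin_num_measure.
    move=> i j ij; apply/subsetPset => x [k /= jk xB]; exists k => //=.
    exact: leq_trans jk.
  rewrite (_ : mu \o A = cst (mu (A 0%N))); last exact/funext.
  by move=> /(cvg_unique _ (cvg_cst _)) => /(_ (@ereal_hausdorff R)).
have D_gt0 : mu (\bigcap_i A i) <> 0.
  rewrite muD => A0; move: B_gt0; rewrite lt_neqAle eq_sym => /andP[/eqP + _].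
  apply; apply: (subset_measure0 (measurable_block 0 n B) (mA 0%N) _ A0).
  by move=> x xB; exists 0%N.
have [//|D1] : mu (\bigcap_i A i) = 0 \/ mu (\bigcap_i A i) = 1%E.
  apply: mu_erg => //; apply/seteqP; split => x Dx i _.
    have [k /= ik xB] : A i.+1 x by rewrite -AS; exact: Dx.
    by exists k => //=; exact: ltnW.
  by change ((T @^-1` A i) x); rewrite AS; exact: Dx.
exists (~` \bigcap_i A i); split; first exact: measurableC.
  by rewrite probability_setC// D1 subee.
move=> x /= + Dx; apply; have [k _ xB] := Dx 0%N I; by exists k.
Qed.

(** There are countably many blocks, and [nu]-null cylinders are [mu]-null. Prefixes of a
    [mu]-typical point are thus words that a quasi-generic sequence for [nu] must contain. *)
Lemma ae_supp {R : realType} (nu mu : probability borel_cantor R) :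
  (forall A, measurable A -> nu A = 0 -> mu A = 0) ->
  {ae mu, forall x : borel_cantor, forall n,
    (0 < nu (cylinder (block x 0 n)))%E}.
Proof.
move=> mu_nu; apply: ae_foralln => n.
have : {ae mu, forall x : borel_cantor, forall C : n.-tuple bool,
    nu (cylinder C) = 0 -> block x 0 n <> C}.
  apply: filter_forall => C.
  have [nuC|nuC] := eqVneq (nu (cylinder C)) 0; last first.
    by apply: aeW => x /eqP; rewrite (negPf nuC).
  have mC : measurable (cylinder C) by exact: measurable_block.
  exists (cylinder C); split => //; first exact: mu_nu.
  by move=> x /= h; apply: contrapT => xC; apply: h.
apply: filterS => x xC; rewrite lt_neqAle measure_ge0 andbT eq_sym.
by apply/eqP => nu0; exact: xC nu0 _.
Qed.

Definition supp_blocks {R : realType} (nu : probability borel_cantor R)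
    (n : nat) : {set n.-tuple bool} :=
  [set B : n.-tuple bool | (0 < nu (cylinder B))%E]%SET.

Lemma ae_nonempty {R : realType} (mu : probability borel_cantor R)
    (P : borel_cantor -> Prop) : {ae mu, forall x, P x} -> exists x, P x.
Proof.
have mu1 : (0 < mu [set: borel_cantor])%E by rewrite probability_setT lte01.
exact: (@filter_ex _ _ (ae_properfilter_algebraOfSetsType mu1)).
Qed.

Lemma supp_blocks_gt0 {R : realType} (nu : probability borel_cantor R)
  (n : nat) : (0 < #|supp_blocks nu n|)%N.
Proof.
have [x xP] := ae_nonempty _ _ (ae_supp nu nu (fun _ _ h => h)).
by apply/card_gt0P; exists (block x 0 n); rewrite inE.
Qed.

Lemma invariant_measure_block {R : realType} (nu : probability borel_cantor R)
    (s n : nat) (B : n.-tuple bool) :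
  invariant_measure (@left_shift bool) nu ->
  nu [set x | block x s n = B] = nu (cylinder B).
Proof.
move=> nu_inv; elim: s => // s <-.
rewrite -[RHS]nu_inv; last exact: measurable_block.
congr (nu _); apply/seteqP; split => x /= <-;
  by apply: eq_from_tnth => j; rewrite !tnth_block.
Qed.

Lemma supp_blocksD {R : realType} (nu : probability borel_cantor R)
    (m n : nat) :
  invariant_measure (@left_shift bool) nu ->
  (#|supp_blocks nu (m + n)| <= #|supp_blocks nu m| * #|supp_blocks nu n|)%N.
Proof.
move=> nu_inv; apply: card_split_le => B; rewrite inE => B_gt0.
split; rewrite inE; apply: (lt_le_trans B_gt0).
  apply: le_measure; rewrite ?inE; [exact: measurable_block..|] => x xB.
  by rewrite /cylinder/= -xB; apply: eq_from_tnth => j; rewrite !tnth_mktuple.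
rewrite -[leRHS](invariant_measure_block _ m)//.
apply: le_measure; rewrite ?inE; [exact: measurable_block..|] => x xB /=.
by rewrite -xB; apply: eq_from_tnth => j; rewrite !tnth_mktuple.
Qed.

Lemma subblock {A : Type} (w v : nat -> A) (i j n s l : nat) :
  block w i n = block v j n -> (s + l <= n)%N ->
  block w (i + s) l = block v (j + s) l.
Proof.
move=> wv sl; apply: eq_from_tnth => k; rewrite !tnth_block -!addnA.
have kn : (s + k < n)%N by rewrite (leq_trans _ sl)// ltn_add2l.
by have := congr1 (fun B => tnth B (Ordinal kn)) wv; rewrite !tnth_block.
Qed.

(** A block charged by [nu] is charged by some component, so the component with most blocks has at
    least a fraction [1 / k] of them. Positivity of its weight gives absolute continuity. *)
Lemma ergodic_component_many_blocks {R : realType}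
    (nu : probability borel_cantor R) (T : borel_cantor -> borel_cantor)
    (k n : nat) :
  has_ergodic_components T nu k ->
  exists mu : probability borel_cantor R, [/\ ergodic_measure T mu,
    forall A, measurable A -> nu A = 0 -> mu A = 0 &
    (#|supp_blocks nu n| <= k * #|supp_blocks mu n|)%N].
Proof.
move=> [c [mu [c_gt0 c_sum _ mu_erg nuE]]].
have k_gt0 : (0 < #|'I_k|)%N.
  rewrite card_ord; case: k c mu c_gt0 c_sum mu_erg nuE => // c mu _.
  by rewrite big_ord0 => /eqP; rewrite eq_sym oner_eq0.
have [i0 i0_max] := bigop.eq_bigmax (fun i => #|supp_blocks (mu i) n|) k_gt0.
exists (mu i0); split => //.
  move=> A mA; rewrite nuE// (bigD1 i0)//= => /eqP.
  rewrite padde_eq0; last 2 first.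
  - by rewrite mule_ge0// lee_fin ltW.
  - by apply: sume_ge0 => i _; rewrite mule_ge0// lee_fin ltW.
  by move=> /andP[]; rewrite mule_eq0 eqe gt_eqF//= => /eqP.
have supp_sub : supp_blocks nu n \subset (\bigcup_i supp_blocks (mu i) n)%SET.
  apply/fintype.subsetP => B; rewrite inE => B_gt0; apply/finset.bigcupP.
  apply: contrapT => noB; move: B_gt0.
  rewrite nuE; last exact: measurable_block.
  rewrite big1 ?ltxx// => i _.
  suff -> : mu i (cylinder B) = 0 by rewrite mule0.
  apply/eqP; rewrite -measure_le0 leNgt; apply/negP => B_gt0.
  by apply: noB; exists i => //; rewrite inE.
apply: (leq_trans (subset_leq_card supp_sub)).
apply: (@leq_trans (\sum_(i < k) #|supp_blocks (mu i) n|)%N).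
  elim/big_ind2: _ => [|a X b' Y aX bY|//]; first by rewrite cards0.
  by rewrite (leq_trans (leq_card_setU _ _))// leq_add.
rewrite -[X in (_ <= X * _)%N]card_ord -sum_nat_const -i0_max.
by apply: leq_sum => i _; exact: leq_bigmax.
Qed.

(* Almost every point of a single ergodic component contains all its blocks at
   multiples of [L], so one long word of positive measure does. Any occurrence of
   that word in [w] exhibits all these blocks in one residue class modulo [L]. *)
Lemma blocks_in_residue_class {R : realType} {w : nat -> bool}
    {nu : probability borel_cantor R} (L b k M : nat) :
  quasi_generic w nu -> (k <= b)%N ->
  has_ergodic_components (iter L (@left_shift bool)) nu k ->
  exists M', (M < M')%N /\ exists (BB : {set L.-tuple bool}) (r : nat),
    (#|supp_blocks nu L| <= b * #|BB|)%N /\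
    forall B, B \in BB -> exists s,
      [/\ (M <= s)%N, (s + L <= M')%N, s = r %[mod L] & block w s L = B].
Proof.
move=> w_nu kb /(ergodic_component_many_blocks nu _ _ L).
move=> [mu [mu_erg mu_nu mu_card]].
have occ : {ae mu, forall x : borel_cantor, forall B : L.-tuple bool,
    B \in supp_blocks mu L -> exists i, block x (i * L) L = B}.
  apply: filter_forall => B.
  case BBB : (B \in supp_blocks mu L); last exact: aeW.
  move: BBB; rewrite inE => /(ergodic_ae_occurs L L B mu mu_erg).
  by apply: filterS.
have [x [x_occ x_supp]] := ae_nonempty _ _ (filterI occ (ae_supp nu mu mu_nu)).
have /choice[i iP] : forall B, exists i, B \in supp_blocks mu L ->
    block x (i * L) L = B.
  move=> B; case BBB : (B \in supp_blocks mu L); last by exists 0%N.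
  by have [i ?] := x_occ _ BBB; exists i.
pose n := ((\max_B i B).+1 * L)%N.
have [a Ma wa] := quasi_generic_occurs w_nu n _ M (x_supp n).
exists (a + n).+1; split; first lia.
exists (supp_blocks mu L), a; split.
  by rewrite (leq_trans mu_card)// leq_mul2r kb orbT.
move=> B /iP xB; have iB : (i B * L + L <= n)%N.
  by rewrite addnC -mulSn leq_mul2r ltnS leq_bigmax orbT.
exists (a + i B * L)%N; split; [lia|lia|by rewrite addnC modnMDl|].
by rewrite (subblock _ _ _ _ _ _ _ wa iB) add0n.
Qed.

(** * Density and block counts of the filled sequence *)

(** The measure enters only through [count], and the density bound is [1 / K], so that the whole
    argument is arithmetic in [nat]. The number [c] counts the window positions lost to the first
    stages. *)
Lemma toeplitz_construction {A : finType} (z : nat -> A) (g : A -> bool)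
    (q b K : nat) (count : nat -> nat) :
  (1 < q)%N -> (0 < K)%N ->
  (forall m M, (0 < m)%N -> exists M', (M < M')%N /\
    exists (BB : {set (q ^ m).-tuple bool}) (r : nat),
    (count (q ^ m)%N <= b * #|BB|)%N /\
    forall B, B \in BB -> exists s, [/\ (M <= s)%N, (s + q ^ m <= M')%N,
      s = r %[mod q ^ m] & block (g \o z) s (q ^ m) = B]) ->
  exists t : nat -> A, [/\ toeplitz t,
    forall N (e : nat -> bool), (forall n, e n -> t n <> z n) ->
      (K * \sum_(n < N) e n <= N)%N &
    forall n0, exists L c, [/\ (n0 <= L)%N, (0 < L)%N, (K * c <= L)%N &
      (count L <= b * (complexity t L * 2 ^ c))%N]].
Proof.
move=> q_gt1 K_gt0 /(exists_levels q K _ q_gt1)[m [M levels]].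
pose L i := (q ^ m i)%N.
have L_gt0 i : (0 < L i)%N by rewrite expn_gt0; lia.
have MKL i : (M i * (K * 2 ^ i.+1) <= L i)%N by have [] := levels i.
have K2_gt0 i : (0 < K * 2 ^ i.+1)%N by rewrite muln_gt0 K_gt0 expn_gt0.
have ML i : (M i <= L i)%N by exact: leq_trans (leq_pmulr _ (K2_gt0 i)) (MKL i).
have M_gt0 i : (0 < M i)%N by have [_ _ /andP[]] := levels i.
have M_incr i : (M i < M i.+1)%N by have [_ _ /andP[]] := levels i.
have m_homo i j : (i <= j)%N -> (m i <= m j)%N.
  move=> /subnKC <-; elim: (j - i)%N => [|n IH]; first by rewrite addn0.
  by rewrite addnS (leq_trans IH)//; have [] := levels (i + n)%N.
have L_dvd i j : (i <= j)%N -> (L i %| L j)%N.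
  by move=> /m_homo; exact: dvdn_exp2l.
have LS_dvd i : (L i %| L i.+1)%N by exact: L_dvd.
have density N j : (K * \sum_(i < j) (N %/ L i) * M i <= N)%N.
  rewrite big_distrr/=.
  apply: (sum_geometric_weights N j (fun i => K * (N %/ L i * M i))%N) => i _.
  apply: leq_trans (leq_trunc_div N (L i)).
  by rewrite [(K * _)%N]mulnC -!mulnA leq_mul2l MKL orbT.
exists (fill L M z); split.
- exact: toeplitz_fill.
- move=> N e eN; apply: leq_trans (density N N).
  by rewrite leq_mul2l (sum_fill_neq_le L M z ML M_gt0 M_incr N e eN) orbT.
move=> j; have [[_ jm] _ _ _ [BB [r [BB_card BBP]]]] := levels j.
(* [F] collects the offsets in a window starting at residue [r] that stages [0] to [j] write. *)
pose F := [set l : 'I_(L j) | [exists i : 'I_j.+1, (r + l) %% L i < M i]%N]%SET.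
exists (L j), #|F|; split => //.
- exact: leq_trans jm (ltnW (ltn_expl _ q_gt1)).
- apply: leq_trans (density (L j) j.+1); rewrite leq_mul2l; apply/orP; right.
  apply: (@leq_trans (\sum_(l < L j) \sum_(i < j.+1) ((r + l) %% L i < M i))%N).
    rewrite -sum1_card big_mkcond/=; apply: leq_sum => l _; rewrite inE.
    by case: existsP => // -[i il]; rewrite (bigD1 i)//= il.
  rewrite exchange_big/=; apply: leq_sum => i _; apply: sum_residues_le.
  by rewrite divnK// L_dvd// -ltnS.
apply: leq_trans BB_card _; rewrite leq_mul2l; apply/orP; right.
apply: (card_blocks_le _ _ g) => B /BBP[s [Ms sM sr <-]]; exists s => l.
rewrite inE negb_exists => /forallP lF; rewrite tnth_block /=; congr g.
(* The window ends below [M j.+1], so stage [j.+1] copies [z] at every position left free by stages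
   [0] to [j]. *)
apply: (fill_fresh L M z ML M_gt0 M_incr _ j.+1).
  by rewrite (leq_trans _ sM)// ltn_add2l.
move=> i ij; have Lij : (L i %| L j)%N by exact: L_dvd.
(* As [L i] divides [L j], the class of [s] modulo [L j] fixes its class modulo [L i]; this is why
   one [F] serves all the occurrences. *)
have -> : ((s + l) %% L i = (r + l) %% L i)%N.
  rewrite -[LHS]modnDml -[RHS]modnDml.
  by rewrite -(modn_dvdm s Lij) -(modn_dvdm r Lij) sr.
by have := lF (Ordinal ij); rewrite -leqNgt.
Qed.

(** * Correlation estimate and choice of constants *)

Lemma trit_valP (R : realType) (a : trit) :
  [\/ trit_val R a = -1, trit_val R a = 0 | trit_val R a = 1].
Proof.
have := valP a; rewrite /trit_val !inE => /or3P[] /eqP ->.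
- by apply: Or31; rewrite mulrN1z.
- by apply: Or32.
- by apply: Or33.
Qed.

(** Replacing a digit [c] by another costs at most 2 in the product, the worst case being a change
    of sign. *)
Lemma trit_val_correlation (R : realType) (a c : trit) :
  trit_val R c ^+ 2 - 2 * (a != c)%:R <= trit_val R a * trit_val R c.
Proof.
have [->|_] := eqVneq a c; first by rewrite mulr0 subr0 expr2.
by case: (trit_valP R a) => ->; case: (trit_valP R c) => -> /=; lra.
Qed.

Lemma bounded_mean {R : realType} (u : nat -> R) :
  (forall i, `|u i| <= 1) -> bounded_fun (mean u).
Proof.
move=> u1; exists 1; split => // x x1 n _ /=.
apply: le_trans (ltW x1); rewrite /mean normrM.
have [->|n0] := posnP n; first by rewrite invr0 normr0 mul0r.
rewrite ger0_norm ?invr_ge0// ler_pdivrMl ?ltr0n// mulr1.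
apply: (le_trans (ler_norm_sum _ _ _)).
by rewrite -[leRHS]mulr1 mulr_natl -[X in _ *+ X]card_ord -sumr_const ler_sum.
Qed.

Theorem theorem7p3 (R : realType) (z : nat -> trit)
    (z_density : 0 < limn_inf (mean (fun i => trit_val R (z i) ^+ 2)))
    (nu : probability borel_cantor R)
    (nu_inv : invariant_measure (@left_shift bool) nu)
    (z_nu : quasi_generic (square_seq z) nu)
    (H_gt0 : 0 < htop_supp nu)
    (nu_components : exists q b : nat, [/\ (2 <= q)%N, (1 <= b)%N &
       forall m : nat, (1 <= m)%N ->
         exists2 k : nat, (k <= b)%N &
           has_ergodic_components (iter (q ^ m) (@left_shift bool)) nu k])
    (eps : R) (eps_gt0 : 0 < eps) :
  exists t : nat -> trit,
    [/\ toeplitz t,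
        (1 - eps) * htop_supp nu <= htop R t &
        0 < limn_inf (mean (fun i => trit_val R (t i) * trit_val R (z i)))].
Proof.
have [q [b [q_gt1 b_gt0 components]]] := nu_components.
have trit1 a : `|trit_val R a| <= 1.
  by case: (trit_valP R a) => ->; rewrite ?normrN ?normr1 ?normr0.
pose l := limn_inf (mean (fun i => trit_val R (z i) ^+ 2)) / 2.
have l_gt0 : 0 < l by rewrite divr_gt0.
have [N0 z_mean] : exists N, forall n, (N <= n)%N ->
    l <= mean (fun i => trit_val R (z i) ^+ 2) n.
  apply: limn_inf_eventually; last first.
    by rewrite ltr_pdivrMr// mulr_natr mulr2n ltrDl.
  by apply: bounded_mean => i; rewrite normrX exprn_ile1.
(* The correlation loses at most [2 * d <= l / 2]. The entropy loses [d] for the factor [b] and [d]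
   for the overwritten positions, together at most [eps * htop_supp nu]. *)
pose d := Num.min (l / 4) (eps * htop_supp nu / 2).
have d_gt0 : 0 < d by rewrite lt_min !divr_gt0// mulr_gt0.
pose K := (Num.bound d^-1).+1.
have K_gt0 : 0 < K%:R :> R by [].
have Kd : K%:R^-1 <= d.
  rewrite -[leRHS]invrK lef_pV2 ?posrE ?invr_gt0//.
  rewrite (le_trans (ltW (archi_boundP _)))// ?invr_ge0 ?(ltW d_gt0)// ler_nat.
  exact: leqnSn.
(* With this digit map, [g \o z] is [square_seq z]. *)
have [m M m_gt0|t [t_toeplitz t_z t_blocks]] :=
    toeplitz_construction z (fun a => val a ^+ 2 == 1) q b K
      (fun n => #|supp_blocks nu n|) q_gt1 isT.
  have [k kb nu_k] := components _ m_gt0.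
  exact: blocks_in_residue_class z_nu kb nu_k.
exists t; split => //.
  apply: fekete_lim_ge => [n|m n|N].
  - exact: log2_nat_ge0.
  - apply: log2_submultiplicative; first exact: complexity_gt0.
    exact: complexityD.
  (* The second summand makes [log2 b <= d * L] for all [L >= n0]. *)
  pose n0 := (N + Num.bound (log2 b%:R / d))%N.
  have [L [c [n0L L_gt0 KcL supp_le]]] := t_blocks n0.
  exists L; first by rewrite (leq_trans _ n0L)// leq_addr.
  have LR : 0 < L%:R :> R by rewrite ltr0n.
  have HL : htop_supp nu <= L%:R^-1 * log2 #|supp_blocks nu L|%:R.
    apply: (@fekete_lim_le _ (fun n => log2 #|supp_blocks nu n|%:R)) => //.
      by move=> n; exact: log2_nat_ge0.
    apply: (log2_submultiplicative (fun n => #|supp_blocks nu n|)) => *.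
      exact: supp_blocks_gt0.
    exact: supp_blocksD.
  have supp_log : log2 #|supp_blocks nu L|%:R <=
      log2 b%:R + log2 (complexity t L)%:R + c%:R :> R.
    rewrite -[c%:R]log2X2 -!log2M ?mulr_gt0 ?ltr0n ?expn_gt0 ?complexity_gt0//.
    rewrite ler_log2 ?ltr0n ?supp_blocks_gt0// -!natrM ler_nat -mulnA.
    exact: supp_le.
  have bL : log2 b%:R <= d * L%:R :> R.
    rewrite mulrC -ler_pdivrMr//.
    have bd_ge0 := divr_ge0 (log2_nat_ge0 b) (ltW d_gt0).
    rewrite (le_trans (ltW (archi_boundP bd_ge0)))//.
    by rewrite ler_nat (leq_trans _ n0L)// leq_addl.
  have cL : c%:R <= d * L%:R :> R.
    rewrite (@le_trans _ _ (K%:R^-1 * L%:R))// ?ler_wpM2r//.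
    by rewrite ler_pdivlMl// -natrM ler_nat.
  have dH : d <= eps * htop_supp nu / 2 by rewrite ge_min lexx orbT.
  move: HL; rewrite ler_pdivlMl// => HL; rewrite ler_pdivlMl//.
  have : L%:R * d <= L%:R * (eps * htop_supp nu / 2) by rewrite ler_pM2l.
  move: HL supp_log bL cL; rewrite /complexity /=; nra.
apply: (@lt_le_trans _ _ (l / 2)); first by rewrite divr_gt0.
apply: (limn_inf_ge (maxn N0 1)).
  by apply: bounded_mean => i; rewrite normrM mulr_ile1.
move=> n; rewrite geq_max => /andP[/z_mean zn n_gt0].
apply: (@le_trans _ _ (mean (fun i => trit_val R (z i) ^+ 2) n - 2 * d)).
  have : d <= l / 4 by rewrite ge_min lexx.
  lra.
have nR : 0 < n%:R :> R by rewrite ltr0n.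
rewrite /mean ler_pdivlMl// mulrBr mulVKf ?gt_eqF//.
have : K%:R * (\sum_(i < n) (t i != z i)%:R) <= n%:R :> R.
  rewrite -natr_sum -natrM ler_nat.
  by apply: (t_z n (fun i => t i != z i)) => i /eqP.
rewrite -ler_pdivlMl// => tz.
have {}tz : \sum_(i < n) (t i != z i)%:R <= n%:R * d.
  by rewrite (le_trans tz)// mulrC ler_wpM2l.
have : \sum_(i < n) (trit_val R (z i) ^+ 2 - 2 * (t i != z i)%:R) <=
    \sum_(i < n) trit_val R (t i) * trit_val R (z i).
  by apply: ler_sum => i _; exact: trit_val_correlation.
rewrite sumrB -mulr_sumr; lra.
Qed.
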